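(* Let $X$ and $Y$ be real-valued random variables with cumulative distribution functions $F_X$ and $F_Y$ and generalised inverses $F_X^{-1}$ and $F_Y^{-1}$. Let $\mathcal{C}$ be the set of all 2-copulas. Then the infimum $$W_1(X,Y)=\inf_{C\in\mathcal{C}}\int_{[0,1]^2}\left|F_X^{-1}(u)-F_Y^{-1}(v)\right|\,dC(u,v)$$ is attained at the copula $C=M$, where $M(u,v)=\min\{u,v\}$ (taking $C=M$ is equivalent to requiring $u=v$, i.e. that the measure induced by $C$ is concentrated on the diagonal $\{u=v\}$ of $[0,1]^2$), and consequently $$W_1(X,Y)=\int_{[0,1]}\left|F_X^{-1}(u)-F_Y^{-1}(u)\right|\,du .$$
   Context: A 2-copula is the restriction to $[0,1]^2$ of a joint cumulative distribution function of two random variables each uniformly distributed on $[0,1]$; $dC$ denotes integration against the probability measure on $[0,1]^2$ with distribution function $C$. The generalised inverse (quantile function) of a distribution function $F$ is $F^{-1}(u)=\inf\{x\in\mathbb{R}: F(x)\ge u\}$; its values at the endpoints $u=0,1$ do not affect the integrals. The (1-)Wasserstein distance between $X$ and $Y$ is $$W_1(X,Y)=\inf_{C\in\mathcal{C}}\int_{\mathbb{R}\times\mathbb{R}}|x-y|\,dC(F_X(x),F_Y(y))=\inf_{C\in\mathcal{C}}\mathbb{E}_C|X-Y|,$$ where $\mathbb{E}_C$ is the expectation when the joint distribution function of $(X,Y)$ is $(x,y)\mapsto C(F_X(x),F_Y(y))$. By Sklar's theorem this is the infimum of $\mathbb{E}|X-Y|$ over all joint distributions with marginals $F_X$ and $F_Y$.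 Via $x=F_X^{-1}(u)$, $y=F_Y^{-1}(v)$ it is written as the infimum over $C\in\mathcal{C}$ of $\int_{[0,1]^2}|F_X^{-1}(u)-F_Y^{-1}(v)|\,dC(u,v)$. All these integrals have nonnegative integrands and are understood as elements of $[0,\infty]$. *)

(* Defs.v *)
From HB Require Import structures.
From mathcomp Require Import all_boot all_order all_algebra.
From mathcomp Require Import all_classical all_reals all_analysis.

Set Implicit Arguments.
Unset Strict Implicit.
Unset Printing Implicit Defensive.
Import Order.TTheory GRing.Theory Num.Theory.
Import numFieldNormedType.Exports.
Local Open Scope classical_set_scope.
Local Open Scope ring_scope.

Definition unit_square (R : realType) : set (R * R) := `[0, 1] `*` `[0, 1].

(* Measures are only pinned down on measurable sets, hence no equality of
   [distribution P U] and [uniform_prob _] as functions. *)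
Definition uniform01 (R : realType) d (T : measurableType d)
    (P : probability T R) (U : {RV P >-> R}) : Prop :=
  forall A : set R, measurable A ->
    distribution P U A = uniform_prob (@ltr01 R) A.

(* A copula is a function on the unit square: the predicate constrains
   [C u v] for u, v in [0, 1] only, and so does everything below, the values
   of [C] elsewhere being never used. *)
Definition copula (R : realType) : set (R -> R -> R) :=
  [set C | exists d (T : measurableType d) (P : probability T R)
             (U V : {RV P >-> R}),
     [/\ uniform01 U, uniform01 V &
       forall u v : R, u \in `[0, 1] -> v \in `[0, 1] ->
         P [set t | U t <= u /\ V t <= v] = (C u v)%:E]].

(* The measure dC. [get] selects an element of a set, with a default value if
   the set is empty; here the set is inhabited for every copula [C], and its
   elements agree on measurable sets. *)
Definition copula_law (R : realType) (C : R -> R -> R) :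
    probability (R * R)%type R :=
  get [set mu : probability (R * R)%type R |
    mu (@unit_square R) = 1%E /\
    forall u v : R, u \in `[0, 1] -> v \in `[0, 1] ->
      mu (`[0, u] `*` `[0, v]) = (C u v)%:E].

Definition copulaM (R : realType) (u v : R) : R := Num.min u v.

(* [cdf] is extended-real valued in the library. *)
Definition rcdf (R : realType) d (T : measurableType d)
    (P : probability T R) (X : {RV P >-> R}) (x : R) : R := fine (cdf X x).

(* For u outside ]0, 1[ the set can be unbounded below or empty, and [inf] is
   then a meaningless default value; the integrals below do not see it. *)
Definition quantile (R : realType) (F : R -> R) (u : R) : R :=
  inf [set x | u <= F x].

(* The law with joint distribution function (x, y) |-> C (F x) (G y). *)
Definition coupling_law (R : realType) (C : R -> R -> R) (F G : R -> R) :
    probability (R * R)%type R :=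
  get [set mu : probability (R * R)%type R |
    forall x y : R, mu (`]-oo, x] `*` `]-oo, y]) = (C (F x) (G y))%:E].

Definition wasserstein1 (R : realType) d (T : measurableType d)
    d' (T' : measurableType d') (P : probability T R) (P' : probability T' R)
    (X : {RV P >-> R}) (Y : {RV P' >-> R}) : \bar R :=
  ereal_inf [set (\int[coupling_law C (rcdf X) (rcdf Y)]_z
                    (`|z.1 - z.2|)%:E)%E | C in @copula R].

Definition copula_cost (R : realType) (F G : R -> R) (C : R -> R -> R) :
    \bar R :=
  (\int[copula_law C]_(z in @unit_square R)
     (`|quantile F z.1 - quantile G z.2|)%:E)%E.

(* Main.v *)
Require Import Defs.
From mathcomp Require Import all_boot all_order all_algebra.
From mathcomp Require Import all_classical all_reals all_analysis.
From mathcomp Require Import measurable_realfun.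
Import Order.TTheory GRing.Theory Num.Theory.
Import numFieldNormedType.Exports.
Local Open Scope classical_set_scope.
Local Open Scope ring_scope.

(** For two random variables f and g on a common space, a real t lies between
    f and g exactly when it belongs to an interval of length |f - g|, so by
    Tonelli
      E|f - g| = int P(f <= t < g or g <= t < f) dt,
    and the integrand is P(f <= t) + P(g <= t) - 2 P(f <= t, g <= t)
    ([expected_distanceE], [probability_separates]). Two consequences drive
    everything. The expected distance depends on the joint distribution
    function of (f, g) alone ([eq_expected_distance]); and for given marginals
    it decreases when the joint distribution function increases on the
    diagonal ([le_expected_distance]).

    A quantile function satisfies F^-1(u) <= x iff u <= F(x) for u in ]0, 1[
    ([quantile_leE]). Hence if h and k are uniform with joint distribution
    function C on the unit square, the joint distribution function of
    (F^-1(h), G^-1(k)) is C (F x) (G y) ([has_copula_quantile_cdf]), and the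
    first consequence identifies the two forms of the cost of C: the integral
    of |x - y| against the coupling law and the integral of
    |F^-1(u) - G^-1(v)| against dC. As C <= M for every copula C, the second
    consequence says that M has the least cost. Since M is the joint
    distribution function of (U, U) with U uniform, its cost is the integral
    of |F^-1(u) - G^-1(u)| over [0, 1].

    The same formula characterises M: if C = M on the square, then E|h - k|
    equals E|U - U| = 0 and h = k almost surely ([has_copulaM_diagonal]).

    The laws [copula_law C] and [coupling_law C F G] are chosen in sets of
    measures with prescribed values on rectangles and on quadrants. These sets
    are inhabited by the laws of (U, V) and of (F^-1(U), G^-1(V)), where (U, V)
    has copula C ([copula_lawP], [coupling_lawP]), and the prescribed values
    are all that the two consequences above require. *)

Set Implicit Arguments.
Unset Strict Implicit.

(** * Measure-theoretic preliminaries *)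

Lemma measurable_set_le {R : realType} {d} {T : measurableType d}
    (f g : T -> R) :
  measurable_fun setT f -> measurable_fun setT g ->
  measurable [set z | f z <= g z].
Proof.
move=> mf mg; have := measurable_fun_ler mf mg measurableT (Y := [set true]) I.
by rewrite setTI.
Qed.

(** Lets the boundary of the unit square, or the complement of the diagonal,
    be ignored when two events are compared. *)
Lemma eq_measure_negligible {R : realType} {d} {T : measurableType d}
    (mu : {measure set T -> \bar R}) (N A B : set T) :
  mu.-negligible N -> measurable A -> measurable B ->
  (forall z, ~ N z -> A z <-> B z) -> mu A = mu B.
Proof.
move=> [N' [mN' N'0 NN']] mA mB AB.
have null C : measurable C -> mu C = mu (C `\` N').
  move=> mC; rewrite (measureDI mu mC mN').
  rewrite [X in (_ + X)%E](_ : _ = 0%E) ?adde0//.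
  by apply/eqP; rewrite -measure_le0 -N'0 le_measure ?inE//; exact: measurableI.
rewrite (null A)// (null B)//; congr (mu _); apply/seteqP.
by split=> z [Az nz]; split => //; apply/AB => // /NN'.
Qed.

Lemma measurable_joint_le {R : realType} {d} {T : measurableType d}
    (f g : T -> R) x y : measurable_fun setT f -> measurable_fun setT g ->
  measurable [set z | f z <= x /\ g z <= y].
Proof.
move=> mf mg; apply: (@measurableI _ _ [set z | f z <= x] [set z | g z <= y]);
  exact: measurable_set_le.
Qed.

Lemma exists_law {R : realType} {d d'} {T : measurableType d}
    {T' : measurableType d'} (P : probability T R) (f : T -> T') :
  measurable_fun setT f ->
  exists mu : probability T' R, forall A, mu A = P (f @^-1` A).
Proof. by move=> mf; exists (distribution P (mfun_Sub (mem_set mf))). Qed.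

(** * The expected distance and the joint distribution function *)

Definition separates (R : realType) T (f g : T -> R) (t : R) : set T :=
  [set z | f z <= t < g z \/ g z <= t < f z].

(** Presents the event by half-spaces, whose measurability and measure are
    known. *)
Lemma separatesE (R : realType) T (f g : T -> R) (t : R) :
  separates f g t =
  ([set z | f z <= t] `\` [set z | g z <= t]) `|`
  ([set z | g z <= t] `\` [set z | f z <= t]).
Proof.
apply/seteqP; split => z; rewrite /separates /=.
- by case=> /andP[-> h]; [left|right]; split=> //; apply/negP; rewrite -ltNge.
- by case=> -[-> /negP]; rewrite -ltNge => ->; [left|right].
Qed.

Section expected_distance.
Context {R : realType} {d} {T : measurableType d} (P : probability T R).
Context (f g : T -> R).
Hypotheses (mf : measurable_fun setT f) (mg : measurable_fun setT g).

(* The second factor carries the sigma-algebra on which the Lebesgue measure is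
   defined, as Tonelli's theorem is applied to [P] and that measure. *)
Let TR : measurableType _ := (T * measurableTypeR R)%type.

Let mSet : measurable [set w : TR | separates f g w.2 w.1].
Proof.
have mf1 : measurable_fun setT (fun w : TR => f w.1).
  exact: measurableT_comp.
have mg1 : measurable_fun setT (fun w : TR => g w.1).
  exact: measurableT_comp.
have mfS : measurable [set w : TR | f w.1 <= w.2] by exact: measurable_set_le.
have mgS : measurable [set w : TR | g w.1 <= w.2] by exact: measurable_set_le.
rewrite (_ : [set w | _] =
  ([set w : TR | f w.1 <= w.2] `\` [set w | g w.1 <= w.2]) `|`
  ([set w | g w.1 <= w.2] `\` [set w | f w.1 <= w.2])).
  by apply: measurableU; apply: measurableD.
by apply/funext => w /=; rewrite separatesE.
Qed.

Let S (w : TR) : \bar R := (\1_[set w : TR | separates f g w.2 w.1] w)%:E.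

Let mS : measurable_fun setT S.
Proof. by apply/measurable_EFinP; exact: measurable_indic. Qed.

Let S_ge0 w : (0 <= S w)%E.
Proof. by rewrite lee_fin. Qed.

Lemma measurable_separates t : measurable (separates f g t).
Proof.
have mfS : measurable [set z | f z <= t] by exact: measurable_set_le.
have mgS : measurable [set z | g z <= t] by exact: measurable_set_le.
by rewrite separatesE; apply: measurableU; apply: measurableD.
Qed.

Let sectionE t : (\int[P]_z S (z, t) = P (separates f g t))%E.
Proof.
transitivity (\int[P]_z (\1_(separates f g t) z)%:E)%E; last first.
  by rewrite integral_indic ?setIT//; exact: measurable_separates.
by apply: eq_integral => z _; rewrite /S !indicE.
Qed.

Lemma measurable_probability_separates :
  measurable_fun setT (fun t => P (separates f g t)).
Proof.
rewrite (_ : (fun t => _) = fubini_G P S).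
  exact: measurable_fun_fubini_tonelli_G.
by apply/funext => t; rewrite -sectionE.
Qed.

(** At a fixed z, the t that separate f z and g z form an interval
    of length |f z - g z|; Tonelli then exchanges the integrals. *)
Lemma expected_distanceE :
  (\int[P]_z (`|f z - g z|)%:E =
   \int[lebesgue_measure]_t P (separates f g t))%E.
Proof.
under [RHS]eq_integral do rewrite -sectionE.
rewrite -(fubini_tonelli S mS)//; apply: eq_integral => z _.
transitivity (\int[lebesgue_measure]_t
  (\1_(`[Num.min (f z) (g z), Num.max (f z) (g z)[%classic) t : R)%:E)%E.
  rewrite integral_indic// setIT/= lebesgue_measure_itv/= lte_fin.
  case: (ltgtP (f z) (g z)) => h; rewrite ?ltxx ?h ?subrr ?normr0// -EFinB;
    congr EFin.
    by rewrite distrC gtr0_norm// subr_gt0.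
  by rewrite gtr0_norm// subr_gt0.
apply: eq_integral => t _; rewrite !indicE; congr ((nat_of_bool _)%:R%:E).
apply/idP/idP; rewrite !inE /= /separates /= in_itv /= ge_min lt_max.
  by move=> /andP[/orP[] a /orP[] b]; [|left|right|];
    rewrite ?a ?b//; have := le_lt_trans a b; rewrite ltxx.
by case=> /andP[-> ->]; rewrite ?orbT.
Qed.

Lemma probability_separates t : (P (separates f g t) =
  (P [set z | (f z <= t)%R] - P [set z | (f z <= t)%R /\ (g z <= t)%R]) +
  (P [set z | (g z <= t)%R] - P [set z | (f z <= t)%R /\ (g z <= t)%R]))%E.
Proof.
have mfS : measurable [set z | f z <= t] by exact: measurable_set_le.
have mgS : measurable [set z | g z <= t] by exact: measurable_set_le.
have fin A : measurable A -> (P A < +oo)%E.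
  by move=> mA; rewrite ltey_eq fin_num_measure.
rewrite separatesE measureU; [|exact: measurableD|exact: measurableD|].
  by rewrite !measureD ?fin//; congr (_ - _ + (_ - P _))%E; rewrite setIC.
by apply/seteqP; split => z //= -[[? ?] [? ?]].
Qed.

End expected_distance.

Section comparison.
Context {R : realType} {d d'} {T : measurableType d} {T' : measurableType d'}.
Context (P : probability T R) (P' : probability T' R).
Context (f g : T -> R) (f' g' : T' -> R).
Hypotheses (mf : measurable_fun setT f) (mg : measurable_fun setT g).
Hypotheses (mf' : measurable_fun setT f') (mg' : measurable_fun setT g').

(** The more likely f and g are to lie on the same side of each level t, the
    closer they are on average. *)
Lemma le_expected_distance :
  (forall t, P [set z | f z <= t] = P' [set z | f' z <= t]) ->
  (forall t, P [set z | g z <= t] = P' [set z | g' z <= t]) ->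
  (forall t, (P' [set z | f' z <= t /\ g' z <= t]%R <=
              P [set z | f z <= t /\ g z <= t]%R)%E) ->
  (\int[P]_z (`|f z - g z|)%:E <= \int[P']_z (`|f' z - g' z|)%:E)%E.
Proof.
move=> eqf eqg lefg; rewrite !expected_distanceE//.
apply: ge0_le_integral => //; try exact: measurable_probability_separates.
by move=> t _; rewrite !probability_separates// eqf eqg leeD// leeB.
Qed.

End comparison.

Lemma cvg_joint_cdf {R : realType} {d} {T : measurableType d}
    (P : probability T R) (f g : T -> R) x :
  measurable_fun setT f -> measurable_fun setT g ->
  P [set z | f z <= x /\ g z <= n%:R] @[n --> \oo] --> P [set z | f z <= x].
Proof.
move=> mf mg.
have mF (n : nat) : measurable [set z | f z <= x /\ g z <= n%:R].
  exact: measurable_joint_le.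
rewrite [X in P X](_ : _ = \bigcup_n [set z | f z <= x /\ g z <= n%:R]).
  apply: nondecreasing_cvg_mu => //; first exact: bigcup_measurable.
  move=> n m nm; apply/subsetPset => z /= [fz gz]; split => //.
  by rewrite (le_trans gz)// ler_nat.
apply/seteqP; split => z /=; last by case=> n _ [].
move=> fz; exists (Num.truncn (g z)).+1 => //=; split=> //.
by rewrite ltW// truncnS_gt.
Qed.

Lemma eq_joint_cdf_marginal {R : realType} {d d'} {T : measurableType d}
    {T' : measurableType d'} (P : probability T R) (P' : probability T' R)
    (f g : T -> R) (f' g' : T' -> R) :
  measurable_fun setT f -> measurable_fun setT g ->
  measurable_fun setT f' -> measurable_fun setT g' ->
  (forall x y, P [set z | f z <= x /\ g z <= y] =
     P' [set z | f' z <= x /\ g' z <= y]) ->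
  forall x, P [set z | f z <= x] = P' [set z | f' z <= x].
Proof.
move=> mf mg mf' mg' eqfg x.
have -> : P [set z | f z <= x] =
    limn (fun n => P [set z | f z <= x /\ g z <= n%:R]).
  by apply/esym/cvg_lim => //; exact: cvg_joint_cdf.
under eq_fun do rewrite eqfg.
by apply/cvg_lim => //; exact: cvg_joint_cdf.
Qed.

(** The distribution of (f, g) enters the expected distance only through its
    joint distribution function, the marginals being limits of the latter. *)
Lemma eq_expected_distance {R : realType} {d d'} {T : measurableType d}
    {T' : measurableType d'} (P : probability T R) (P' : probability T' R)
    (f g : T -> R) (f' g' : T' -> R) :
  measurable_fun setT f -> measurable_fun setT g ->
  measurable_fun setT f' -> measurable_fun setT g' ->
  (forall x y, P [set z | f z <= x /\ g z <= y] =
     P' [set z | f' z <= x /\ g' z <= y]) ->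
  (\int[P]_z (`|f z - g z|)%:E = \int[P']_z (`|f' z - g' z|)%:E)%E.
Proof.
move=> mf mg mf' mg' eqfg.
have eqgf x y : P [set z | g z <= x /\ f z <= y] =
     P' [set z | g' z <= x /\ f' z <= y].
  have swap (U : Type) (h k : U -> R) :
      [set z | h z <= x /\ k z <= y] = [set z | k z <= y /\ h z <= x].
    by apply/seteqP; split => z [].
  by rewrite !swap.
have eqf := eq_joint_cdf_marginal mf mg mf' mg' eqfg.
have eqg := eq_joint_cdf_marginal mg mf mg' mf' eqgf.
by apply/eqP; rewrite eq_le; apply/andP; split;
  apply: le_expected_distance => // t; rewrite eqfg.
Qed.

(** * Quantile functions *)

Section quantile.
Context {R : realType} {d} {T : measurableType d} {P : probability T R}.
Context (X : {RV P >-> R}).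

Lemma rcdf01 x : rcdf X x \in `[0, 1].
Proof.
rewrite in_itv /= -!lee_fin fineK ?fin_num_measure//.
by rewrite cdf_ge0 cdf_le1.
Qed.

Lemma rcdf_nondecreasing : {homo rcdf X : x y / x <= y}.
Proof.
by move=> x y xy; rewrite fine_le ?fin_num_measure//; exact: cdf_nondecreasing.
Qed.

(** The set whose infimum is taken is nonempty and bounded below because F tends
    to 1 and 0 at infinity, and it contains its infimum because F is
    right-continuous. *)
Lemma quantile_leE u x : 0 < u < 1 ->
  (quantile (rcdf X) u <= x) = (u <= rcdf X x).
Proof.
move=> /andP[u0 u1].
have [a ua] : exists a, u < rcdf X a.
  have /(cvgr_gt 1)/(_ u u1) /filter_ex[a ua] : rcdf X y @[y --> +oo] --> (1:R).
    by apply: fine_cvg; exact: cvg_cdfy1.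
  by exists a.
have [b bu] : exists b, rcdf X b < u.
  have /(cvgr_lt 0)/(_ u u0) /filter_ex[b bu] : rcdf X y @[y --> -oo] --> (0:R).
    by apply: fine_cvg; exact: cvg_cdfNy0.
  by exists b.
have lbA : lbound [set y | u <= rcdf X y] b.
  move=> y /= uy; rewrite leNgt; apply/negP => yb.
  have := lt_le_trans bu (le_trans uy (rcdf_nondecreasing (ltW yb))).
  by rewrite ltxx.
apply/idP/idP => [qx|ux]; last by apply: ge_inf => //; exists b.
rewrite leNgt; apply/negP => Fx.
have /(cvgr_lt (rcdf X x))/(_ u Fx) cx : rcdf X y @[y --> x^'+] --> rcdf X x.
  apply: fine_cvg; rewrite fineK ?fin_num_measure//.
  exact: cdf_right_continuous.
have [y [xy Fy]] : exists y, x < y /\ rcdf X y < u.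
  have /filter_ex[y [? ?]] : \forall y \near x^'+, x < y /\ rcdf X y < u.
    by near=> y; split; near: y => //; exact: nbhs_right_gt.
  by exists y.
have hi : has_inf [set y | u <= rcdf X y].
  by split; [exists a; exact: ltW|exists b].
have [z uz] := inf_adherent (eps := y - x) (ltac:(by rewrite subr_gt0)) hi.
move=> zi; have zy : z <= y.
  rewrite ltW// (lt_le_trans zi)// -[leRHS](subrK x) addrC lerD2l//.
by have := lt_le_trans Fy (le_trans uz (rcdf_nondecreasing zy)); rewrite ltxx.
Unshelve. all: by end_near. Qed.

(** On ]0, 1[ this is the equivalence of [quantile_leE]. Elsewhere the function
    takes at most two values: for u <= 0 or u > 1 the infimum is over a set that
    is not bounded below or is empty, hence 0 by convention. *)
Lemma measurable_quantile : measurable_fun setT (quantile (rcdf X)).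
Proof.
rewrite (_ : quantile _ = fun u =>
  if (0 < u) && (u < 1) then quantile (rcdf X) u else
  if u == 1 then quantile (rcdf X) 1 else 0); last first.
  apply/funext => u; case: ifPn => // nu; case: eqVneq => [->//|u1].
  apply: inf_out; have [u0|u0] := leP u 0.
    move=> [_ [b]] /(_ (b - 1)) /=; rewrite lerDl oppr_ge0 ler10.
    suff ub : u <= rcdf X (b - 1) by move=> /(_ ub).
    by have := rcdf01 (b - 1); rewrite in_itv => /andP[+ _]; exact: le_trans.
  move=> [[y /= uy] _]; move: nu; rewrite u0 /= lt_neqAle u1 /=.
  by have := rcdf01 y; rewrite in_itv => /andP[_]; move/(le_trans uy) ->.
apply: measurable_fun_if => //.
- by apply: measurable_and; exact: measurable_fun_ltr.
- apply: (measurability (@RGenOInfty.G R)).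
    exact: RGenOInfty.measurableE.
  move=> /= _ [_ [r ->] <-]; rewrite setTI.
  rewrite (_ : _ `&` _ = `]0, 1[ `&` `]rcdf X r, +oo[).
    exact: measurableI.
  apply/seteqP; split => u /=; rewrite !in_itv /= !andbT.
    by move=> [u01]; rewrite ltNge quantile_leE// -ltNge => ->.
  by move=> [u01]; rewrite ltNge -quantile_leE// -ltNge => ->.
- apply: measurable_funS (measurableT) _ _ => //.
  apply: measurable_fun_ifT => //; exact: measurable_fun_eqr.
Qed.

End quantile.

(** * Pairs of uniform variables with a given copula *)

Definition uniform_cdf {R : realType} {d} {T : measurableType d}
  (P : probability T R) (h : T -> R) :=
  forall u, u \in `[0, 1] -> P [set t | h t <= u] = u%:E.

(** The quantile function is controlled on ]0, 1[ only; a uniform variable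
    avoids both endpoints almost surely. *)
Lemma uniform_cdf_negligible {R : realType} {d} {T : measurableType d}
    (P : probability T R) (h : T -> R) :
  measurable_fun setT h -> uniform_cdf P h ->
  P.-negligible [set t | ~ 0 < h t < 1].
Proof.
move=> mh Ph.
have m1 : measurable [set t | 1 <= h t] by exact: measurable_set_le.
have n0 : P.-negligible [set t | h t <= 0].
  exists [set t | h t <= 0]; split=> //; first exact: measurable_set_le.
  by rewrite Ph// in_itv /= lexx ler01.
(* The event h = 1 is contained in h > 1 - e, of probability e, for all e. *)
have n1 : P.-negligible [set t | 1 <= h t].
  exists [set t | 1 <= h t]; split=> //.
  apply/eqP; rewrite -measure_le0; apply/lee_addgt0Pr => e e0; rewrite add0e.
  have [e1|e1] := leP 1 e.
    by rewrite (le_trans (probability_le1 _ _)).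
  rewrite (@le_trans _ _ (P (~` [set t | h t <= 1 - e])))//.
    rewrite le_measure ?inE//.
      by apply: measurableC; exact: measurable_set_le.
    move=> t /= h1; apply/negP; rewrite -ltNge (lt_le_trans _ h1)//.
    by rewrite ltrBlDr ltrDl.
  rewrite probability_setC; last exact: measurable_set_le.
  rewrite Ph; last by rewrite in_itv /= subr_ge0 ltW//= gerBl ltW.
  by rewrite -EFinB lee_fin opprB addrC subrK.
apply: (negligibleS _ (negligibleU n0 n1)) => t /= /negP.
by rewrite negb_and -!leNgt => /orP[]; [left|right].
Qed.

(** Stated on an arbitrary space, so that one lemma applies to the coordinates
    under [copula_law C], to the variables given by [copula C], and to the
    pair (id, id) under the uniform law. *)
Definition has_copula {R : realType} {d} {T : measurableType d}
  (C : R -> R -> R) (P : probability T R) (h k : T -> R) : Prop :=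
  [/\ measurable_fun setT h, measurable_fun setT k, uniform_cdf P h,
    uniform_cdf P k &
    forall u v, u \in `[0, 1] -> v \in `[0, 1] ->
      P [set t | h t <= u /\ k t <= v] = (C u v)%:E].

Section has_copula.
Context {R : realType} {d} {T : measurableType d}.
Context (C : R -> R -> R) (P : probability T R) (h k : T -> R).
Hypothesis hk : has_copula C P h k.

Lemma has_copula_negligible :
  P.-negligible [set t | ~ (0 < h t < 1 /\ 0 < k t < 1)].
Proof.
case: hk => mh mk Ph Pk _.
apply: (negligibleS _ (negligibleU (uniform_cdf_negligible mh Ph)
  (uniform_cdf_negligible mk Pk))) => t /=.
by move/not_andP.
Qed.

(** Used with quantile functions for phi and psi, and with the identity, where a
    and b are then x and y truncated to the unit interval. *)
Lemma has_copula_joint_cdf (phi psi : R -> R) x y a b :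
  measurable_fun setT phi -> measurable_fun setT psi ->
  a \in `[0, 1] -> b \in `[0, 1] ->
  (forall u, 0 < u < 1 -> (phi u <= x) = (u <= a)) ->
  (forall v, 0 < v < 1 -> (psi v <= y) = (v <= b)) ->
  P [set t | phi (h t) <= x /\ psi (k t) <= y] = (C a b)%:E.
Proof.
case: (hk) => mh mk _ _ Phk mphi mpsi a01 b01 phia psib.
rewrite -(Phk a b)//; apply: (eq_measure_negligible has_copula_negligible).
- by apply: measurable_joint_le; exact: measurableT_comp.
- exact: measurable_joint_le.
- by move=> t /contrapT[h01 k01] /=; rewrite phia// psib.
Qed.

Lemma has_copula_marginals u v : u \in `[0, 1] -> v \in `[0, 1] ->
  C u 1 = u /\ C 1 v = v.
Proof.
case: (hk) => mh mk Ph Pk Phk u01 v01.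
have i1 : 1 \in `[0, (1:R)] by rewrite in_itv /= ler01 lexx.
split; apply: EFin_inj; rewrite -Phk//.
- rewrite -Ph//; apply: (eq_measure_negligible has_copula_negligible).
  + exact: measurable_joint_le.
  + exact: measurable_set_le.
  + by move=> t /contrapT[_ /andP[_ /ltW k1]] /=; rewrite k1; split=> [[]|].
- rewrite -Pk//; apply: (eq_measure_negligible has_copula_negligible).
  + exact: measurable_joint_le.
  + exact: measurable_set_le.
  + by move=> t /contrapT[/andP[_ /ltW h1] _] /=; rewrite h1; split=> [[]|].
Qed.

(** The upper Frechet-Hoeffding bound. *)
Lemma has_copula_le_min u v : u \in `[0, 1] -> v \in `[0, 1] ->
  C u v <= copulaM u v.
Proof.
case: (hk) => mh mk Ph Pk Phk u01 v01.
rewrite /copulaM le_min -!lee_fin -Phk// -Ph// -Pk//.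
by rewrite !le_measure ?inE//;
  try exact: measurable_set_le; try exact: measurable_joint_le; move=> t [].
Qed.

End has_copula.

Lemma uniform_prob01_itv {R : realType} (u : R) : u \in `[0, 1] ->
  uniform_prob (@ltr01 R) `]-oo, u] = u%:E.
Proof.
rewrite in_itv /= => /andP[u0 u1].
transitivity (\int[uniform_prob (@ltr01 R)]_x (\1_(`]-oo, u] : set R) x)%:E)%E.
  by rewrite integral_indic// setIT.
rewrite integral_uniform//; last first.
  by apply/measurable_EFinP; exact: measurable_indic.
rewrite subr0 invr1 mul1e integral_indic//.
rewrite (_ : _ `&` _ = `[0, u]%classic); last first.
  apply/seteqP; split => x /=; rewrite !in_itv /=.
    by move=> [-> /andP[->]].
  by move=> /andP[-> xu]; rewrite xu (le_trans xu).
rewrite /= lebesgue_measure_itv /= lte_fin sube0.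
by case: ltgtP u0 => // <-.
Qed.

Lemma uniform01_cdf {R : realType} {d} {T : measurableType d}
    (P : probability T R) (U : {RV P >-> R}) : uniform01 U -> uniform_cdf P U.
Proof.
by move=> PU u u01; rewrite -(uniform_prob01_itv u01) -PU.
Qed.

Lemma copula_has_copula {R : realType} (C : R -> R -> R) : copula C ->
  exists d (T : measurableType d) (P : probability T R) (U V : T -> R),
    has_copula C P U V.
Proof.
move=> [d [T [P [U [V [PU PV PUV]]]]]]; exists d, T, P, U, V.
by split => //; exact: uniform01_cdf.
Qed.

Lemma has_copulaM_uniform (R : realType) :
  has_copula (@copulaM R) (uniform_prob (@ltr01 R)) id id.
Proof.
have id_uniform : uniform_cdf (uniform_prob (@ltr01 R)) id.
  by move=> u u01; rewrite -(uniform_prob01_itv u01).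
split => // u v u01 v01.
rewrite -id_uniform; last by rewrite /copulaM; case: leP.
by congr uniform_prob; apply/seteqP; split=> t /=;
  rewrite /copulaM le_min => /andP.
Qed.

Lemma copula_copulaM (R : realType) : copula (@copulaM R).
Proof.
have mid : measurable_fun setT (@id (measurableTypeR R) : _ -> R).
  exact: measurable_id.
pose U : {RV uniform_prob (@ltr01 R) >-> R} :=
  @mfun_Sub _ _ (measurableTypeR R) R id (mem_set mid).
exists _, (measurableTypeR R), (uniform_prob (@ltr01 R)), U, U.
case: (has_copulaM_uniform R) => _ _ _ _ H.
by split => //; move=> A mA.
Qed.

(** The law of (U, V) belongs to the set from which [copula_law C] is chosen. *)
Lemma copula_lawP {R : realType} (C : R -> R -> R) : copula C ->
  copula_law C (@unit_square R) = 1%E /\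
  forall u v : R, u \in `[0, 1] -> v \in `[0, 1] ->
    copula_law C (`[0, u] `*` `[0, v]) = (C u v)%:E.
Proof.
move=> /copula_has_copula[d [T [P [U [V UV]]]]].
apply: (getPex (P := [set mu : probability (R * R)%type R |
  mu (@unit_square R) = 1%E /\ forall u v : R, u \in `[0, 1] -> v \in `[0, 1] ->
    mu (`[0, u] `*` `[0, v]) = (C u v)%:E])).
have [mU mV PU PV PUV] := UV.
have [mu muE] := exists_law P (measurable_fun_pair mU mV).
exists mu; split => [|u v u01 v01]; rewrite muE.
- rewrite -(probability_setT P).
  apply: (eq_measure_negligible (has_copula_negligible UV)) => //.
    rewrite -[X in measurable X]setTI.
    by apply: measurable_fun_pair => //; exact: measurableX.
  move=> t /contrapT[/andP[U0 U1] /andP[V0 V1]]; split => // _.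
  by split; rewrite /= in_itv /= !ltW.
- rewrite -PUV//.
  apply: (eq_measure_negligible (has_copula_negligible UV)) => //.
  + rewrite -[X in measurable X]setTI.
    by apply: measurable_fun_pair => //; exact: measurableX.
  + exact: measurable_joint_le.
  move=> t /contrapT[/andP[U0 U1] /andP[V0 V1]] /=; rewrite !in_itv /=.
  by rewrite (ltW U0) (ltW V0).
Qed.

Lemma copula_law_setC_square {R : realType} (C : R -> R -> R) : copula C ->
  copula_law C (~` @unit_square R) = 0%E.
Proof.
move=> /copula_lawP[sq1 _]; rewrite probability_setC; last exact: measurableX.
by rewrite sq1 subee.
Qed.

Lemma has_copula_copula_law {R : realType} (C : R -> R -> R) : copula C ->
  has_copula C (copula_law C) fst snd.
Proof.
move=> cC; have [_ rect] := copula_lawP cC.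
have [d [T [P [U [V UV]]]]] := copula_has_copula cC.
have nsq : (copula_law C).-negligible (~` @unit_square R).
  exists (~` @unit_square R); split => //; last exact: copula_law_setC_square.
  by apply: measurableC; exact: measurableX.
have mrect u v : measurable (`[0, u]%classic `*` `[0, v]%classic : set (R * R)).
  exact: measurableX.
have i1 : 1 \in `[0, (1:R)] by rewrite in_itv /= ler01 lexx.
split => //.
- move=> u u01; have [Cu _] := has_copula_marginals UV u01 u01.
  rewrite -[in RHS]Cu -rect//; apply: (eq_measure_negligible nsq) => //.
    exact: measurable_set_le.
  move=> z /contrapT[]; rewrite /= !in_itv /= => /andP[-> _] /andP[-> ->].
  by split => [->|[]].
- move=> u u01; have [_ Cu] := has_copula_marginals UV u01 u01.
  rewrite -[in RHS]Cu -rect//; apply: (eq_measure_negligible nsq) => //.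
    exact: measurable_set_le.
  move=> z /contrapT[]; rewrite /= !in_itv /= => /andP[-> ->] /andP[-> _].
  by split => [->|[]].
- move=> u v u01 v01; rewrite -rect//; apply: (eq_measure_negligible nsq) => //.
    exact: measurable_joint_le.
  by move=> z /contrapT[]; rewrite /= !in_itv /= => /andP[-> _] /andP[-> _].
Qed.

(** * The comonotone copula and the diagonal *)

(** If C = M, then (h, k) has the joint distribution function of (U, U), so
    E|h - k| = 0. Conversely, if h = k almost surely, then h <= u and k <= v
    together mean that h <= min(u, v). *)
Lemma has_copulaM_diagonal {R : realType} {d} {T : measurableType d}
    (C : R -> R -> R) (P : probability T R) (h k : T -> R) :
  has_copula C P h k ->
  (forall u v, u \in `[0, 1] -> v \in `[0, 1] -> C u v = copulaM u v) <->
  P.-negligible [set t | h t <> k t].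
Proof.
move=> hk; have [mh mk Ph Pk Phk] := hk; split => [CM|diag u v u01 v01].
  (* Joint distribution functions are compared at all real arguments, whereas
     [C] is known on the unit square only. *)
  have clip (x : R) : exists2 a, a \in `[0, 1] &
      forall u, 0 < u < 1 -> (u <= x) = (u <= a).
    exists (Num.max 0 (Num.min 1 x)).
      by rewrite in_itv /= le_max lexx /= ge_max ler01 ge_min lexx.
    by move=> u /andP[u0 u1]; rewrite le_max le_min leNgt u0 /= (ltW u1).
  have mid : measurable_fun setT (@id R) by exact: measurable_id.
  have E0 : (\int[P]_t (`|h t - k t|)%:E = 0)%E.
    rewrite (@eq_expected_distance _ _ _ _ _ P (uniform_prob (@ltr01 R))
      h k id id)//.
      by apply: integral0_eq => t _; rewrite subrr normr0.
    move=> x y; have [a a01 xa] := clip x; have [b b01 yb] := clip y.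
    rewrite (has_copula_joint_cdf hk mid mid a01 b01 xa yb) CM//.
    have UU := has_copulaM_uniform R.
    by rewrite (has_copula_joint_cdf UU mid mid a01 b01 xa yb).
  have [|+ _] :=
    ae_eq_integral_abs P measurableT (f := fun t => (h t - k t)%:E).
    by apply/measurable_EFinP; exact: measurable_funB.
  move=> /(_ E0); apply: negligibleS => t /= hkt /(_ I) [] /eqP.
  by rewrite subr_eq0 => /eqP.
rewrite /copulaM; apply: EFin_inj; rewrite -Phk// -Ph; last by case: leP.
apply: (eq_measure_negligible diag).
- exact: measurable_joint_le.
- exact: measurable_set_le.
- by move=> t /contrapT /= <-; rewrite le_min; split => [[-> ->]|/andP].
Qed.

(** * Costs of couplings *)

Lemma inverse_transform {R : realType} {d d'} {T : measurableType d}
    {T' : measurableType d'} (P : probability T R) (P' : probability T' R)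
    (X : {RV P >-> R}) (h : T' -> R) x :
  measurable_fun setT h -> uniform_cdf P' h ->
  P' [set t | quantile (rcdf X) (h t) <= x] = (rcdf X x)%:E.
Proof.
move=> mh P'h; rewrite -P'h ?rcdf01//.
apply: (eq_measure_negligible (uniform_cdf_negligible mh P'h)).
- apply: measurable_set_le => //; apply: measurableT_comp => //.
  exact: measurable_quantile.
- exact: measurable_set_le.
- by move=> t /contrapT h01 /=; rewrite quantile_leE.
Qed.

Section quantile_coupling.
Context {R : realType} {d d'} {T : measurableType d} {T' : measurableType d'}.
Context {P : probability T R} {P' : probability T' R}.
Context (X : {RV P >-> R}) (Y : {RV P' >-> R}).

Let qX := quantile (rcdf X).
Let qY := quantile (rcdf Y).

Lemma has_copula_quantile_cdf {d1} {T1 : measurableType d1} (C : R -> R -> R)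
    (P1 : probability T1 R) (h k : T1 -> R) x y : has_copula C P1 h k ->
  P1 [set t | qX (h t) <= x /\ qY (k t) <= y] = (C (rcdf X x) (rcdf Y y))%:E.
Proof.
move=> hk; apply: (has_copula_joint_cdf hk); try exact: measurable_quantile;
  try exact: rcdf01; by move=> u u01; exact: quantile_leE.
Qed.

(** For the same marginal quantile functions, a larger copula has a smaller
    cost. With C1 = C2 in both directions it also shows that the cost depends
    on the copula alone. *)
Lemma le_quantile_distance {d1 d2} {T1 : measurableType d1}
    {T2 : measurableType d2} (C1 C2 : R -> R -> R) (P1 : probability T1 R)
    (P2 : probability T2 R) (h1 k1 : T1 -> R) (h2 k2 : T2 -> R) :
  has_copula C1 P1 h1 k1 -> has_copula C2 P2 h2 k2 ->
  (forall u v, u \in `[0, 1] -> v \in `[0, 1] -> C1 u v <= C2 u v) ->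
  (\int[P2]_t (`|qX (h2 t) - qY (k2 t)|)%:E <=
   \int[P1]_t (`|qX (h1 t) - qY (k1 t)|)%:E)%E.
Proof.
move=> hk1 hk2 C12.
have [mh1 mk1 Ph1 Pk1 _] := hk1; have [mh2 mk2 Ph2 Pk2 _] := hk2.
apply: (@le_expected_distance _ _ _ _ _ P2 P1 (qX \o h2) (qY \o k2)
    (qX \o h1) (qY \o k1));
  try by apply: measurableT_comp => //; exact: measurable_quantile.
- by move=> t; rewrite !inverse_transform.
- by move=> t; rewrite !inverse_transform.
- move=> t; rewrite (has_copula_quantile_cdf t t hk1).
  by rewrite (has_copula_quantile_cdf t t hk2) lee_fin C12 ?rcdf01.
Qed.

Lemma copula_costE {d1} {T1 : measurableType d1} (C : R -> R -> R)
    (P1 : probability T1 R) (h k : T1 -> R) : copula C -> has_copula C P1 h k ->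
  copula_cost (rcdf X) (rcdf Y) C = (\int[P1]_t (`|qX (h t) - qY (k t)|)%:E)%E.
Proof.
move=> cC hk; rewrite (_ : (\int[P1]_t _)%E =
    (\int[copula_law C]_z (`|qX z.1 - qY z.2|)%:E)%E); last first.
  by apply/eqP; rewrite eq_le !(le_quantile_distance (C1 := C) (C2 := C))//;
    exact: has_copula_copula_law.
have msq : measurable (@unit_square R) by exact: measurableX.
rewrite /copula_cost -/qX -/qY.
rewrite (@ge0_negligible_integral _ _ _ (copula_law C) setT
  (~` @unit_square R))//.
- by rewrite setTD setCK.
- exact: measurableC.
- apply/measurable_EFinP/measurableT_comp => //.
  by apply: measurable_funB; apply: measurableT_comp => //;
    exact: measurable_quantile.
- exact: copula_law_setC_square.
Qed.

(** The law of (F^-1(U), G^-1(V)), where (U, V) has copula C, belongs to the set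
    from which [coupling_law] is chosen. *)
Lemma coupling_lawP (C : R -> R -> R) : copula C -> forall x y,
  coupling_law C (rcdf X) (rcdf Y) (`]-oo, x] `*` `]-oo, y]) =
    (C (rcdf X x) (rcdf Y y))%:E.
Proof.
move=> cC; apply: (getPex (P := [set mu : probability (R * R)%type R |
  forall x y : R, mu (`]-oo, x] `*` `]-oo, y]) =
    (C (rcdf X x) (rcdf Y y))%:E])).
have := has_copula_copula_law cC; set nu := copula_law C => hk.
have [mu muE] := @exists_law _ _ _ _ (R * R)%type nu
  (fun z => (qX z.1, qY z.2)) (measurable_fun_pair
   (measurableT_comp (measurable_quantile X) measurable_fst)
   (measurableT_comp (measurable_quantile Y) measurable_snd)).
exists mu => x y; rewrite muE -(has_copula_quantile_cdf x y hk).
congr (nu _).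
Qed.

(** Both integrals are expected distances of pairs with joint distribution
    function C (F x) (G y). *)
Lemma coupling_law_costE (C : R -> R -> R) : copula C ->
  (\int[coupling_law C (rcdf X) (rcdf Y)]_z (`|z.1 - z.2|)%:E =
   copula_cost (rcdf X) (rcdf Y) C)%E.
Proof.
move=> cC; have hk := has_copula_copula_law cC.
rewrite (copula_costE cC hk).
apply: (@eq_expected_distance _ _ _ _ _ _ _ fst snd
  (fun z => qX z.1) (fun z => qY z.2)) => //;
  try by apply: measurableT_comp => //; exact: measurable_quantile.
by move=> x y; rewrite (has_copula_quantile_cdf x y hk) -coupling_lawP.
Qed.

Lemma copula_cost_minM (C : R -> R -> R) : copula C ->
  (copula_cost (rcdf X) (rcdf Y) (@copulaM R) <=
   copula_cost (rcdf X) (rcdf Y) C)%E.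
Proof.
move=> cC; have hk := has_copula_copula_law cC.
have hkM := has_copulaM_uniform R.
rewrite (copula_costE cC hk) (copula_costE (copula_copulaM R) hkM).
by apply: (le_quantile_distance hk hkM); exact: (has_copula_le_min hk).
Qed.

End quantile_coupling.

Theorem theorem2p1 (R : realType) (d d' : measure_display)
    (T : measurableType d) (T' : measurableType d')
    (P : probability T R) (P' : probability T' R)
    (X : {RV P >-> R}) (Y : {RV P' >-> R}) :
  [/\ wasserstein1 X Y =
        ereal_inf [set copula_cost (rcdf X) (rcdf Y) C | C in @copula R],
      copula (@copulaM R) /\
        wasserstein1 X Y = copula_cost (rcdf X) (rcdf Y) (@copulaM R),
      forall C : R -> R -> R, copula C ->
        (forall u v : R, u \in `[0, 1] -> v \in `[0, 1] ->
           C u v = copulaM u v) <->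
        copula_law C [set z : R * R | unit_square z /\ z.1 = z.2] = 1%E &
      wasserstein1 X Y =
        (\int[@lebesgue_measure R]_(u in `[0%R, 1%R])
           (`|quantile (rcdf X) u - quantile (rcdf Y) u|)%:E)%E].
Proof.
have cM := copula_copulaM R.
have W1E : wasserstein1 X Y =
    ereal_inf [set copula_cost (rcdf X) (rcdf Y) C | C in @copula R].
  rewrite /wasserstein1; congr ereal_inf; apply/seteqP.
  by split => _ [C cC <-]; exists C => //; rewrite coupling_law_costE.
have W1M : wasserstein1 X Y = copula_cost (rcdf X) (rcdf Y) (@copulaM R).
  rewrite W1E; apply/eqP; rewrite eq_le; apply/andP; split.
    by apply: ereal_inf_lbound; exists (@copulaM R).
  by apply: le_ereal_inf_tmp => _ [C cC <-]; exact: copula_cost_minM.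
split => //.
- move=> C cC; have hk := has_copula_copula_law cC.
  have msq : measurable (@unit_square R) by exact: measurableX.
  have meq : measurable [set z : R * R | z.1 = z.2].
    rewrite (_ : mkset _ = [set z | z.1 <= z.2] `&` [set z | z.2 <= z.1]).
      by apply: measurableI; exact: measurable_set_le.
    apply/seteqP; split => z /=; first by move=> ->.
    by move=> [a b]; apply/eqP; rewrite eq_le a b.
  have mD : measurable [set z : R * R | unit_square z /\ z.1 = z.2].
    exact: measurableI.
  rewrite (has_copulaM_diagonal hk); split => [neg|D1].
    rewrite -(copula_lawP cC).1; apply: (eq_measure_negligible neg) => //.
    by move=> z /contrapT zz; split => [[]|].
  exists (~` [set z : R * R | unit_square z /\ z.1 = z.2]); split.
  + exact: measurableC.
  + by rewrite probability_setC// D1 subee.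
  + by move=> z /= ne [_ /ne].
- rewrite W1M (copula_costE X Y cM (has_copulaM_uniform R)) integral_uniform//.
    by rewrite subr0 invr1 mul1e.
  apply/measurable_EFinP/measurableT_comp => //.
  by apply: measurable_funB; exact: measurable_quantile.
Qed.
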